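(* Let $(R,\mathfrak m)$ be a commutative noetherian local ring with $\mathfrak m^3=0$ that is not Gorenstein. If there exists a totally reflexive $R$-module without free summands, which is presented by a matrix that has a column or a row with only one non-zero entry, then that entry is an exact zero divisor in $R$.
   Context: For $x\in R$, $(0:x)$ denotes the annihilator of $x$. A non-invertible element $x\neq 0$ of $R$ is an exact zero divisor if there is an element $w\in R$ with $(0:x)=(w)$ and $(0:w)=(x)$. A finitely generated $R$-module $M$ is totally reflexive if there is an exact sequence $F\colon \cdots\to F_1\to F_0\to F_{-1}\to\cdots$ (infinite in both directions) of finitely generated free $R$-modules such that $M\cong\operatorname{Coker}(F_1\to F_0)$ and the dual sequence $\operatorname{Hom}_R(F,R)$ is also exact. A module $M$ is presented by a matrix $\Psi$ with entries in $R$ if $M$ is isomorphic to the cokernel of the homomorphism of finitely generated free $R$-modules given by $\Psi$.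
   Formalization: The presenting matrix is required to be minimal (entries in the maximal ideal m, kernel of the matrix inside m times the free module), since for an arbitrary presentation the claim fails: adding a 1×1 block (1) gives a row whose only non-zero entry is a unit. *)

(* Defs.v *)
From HB Require Import structures.
From mathcomp Require Import all_boot all_order all_algebra.
From mathcomp Require Import boolp classical_sets.

Set Implicit Arguments.
Unset Strict Implicit.
Unset Printing Implicit Defensive.

Import GRing.Theory.

Local Open Scope classical_set_scope.
Local Open Scope ring_scope.

Section Rings.
Variable R : comUnitRingType.
Implicit Types (I J m : set R) (x w : R).

(* The unit ideal is allowed, unlike in [idealr_closed] of ring_quotient. *)
Definition is_ideal I : Prop :=
  I 0 /\ forall a x y, I x -> I y -> I (a * x + y).

Definition ideal_gen (n : nat) (g : 'I_n -> R) : set R :=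
  [set x | exists c : 'I_n -> R, x = \sum_(i < n) c i * g i].

Definition noetherian : Prop :=
  forall I, is_ideal I -> exists (n : nat) (g : 'I_n -> R), I = ideal_gen g.

Definition maximal_ideal m : Prop :=
  [/\ is_ideal m, m != setT &
      forall I, is_ideal I -> m `<=` I -> I = m \/ I = setT].

Definition local_ring m : Prop :=
  maximal_ideal m /\ forall m', maximal_ideal m' -> m' = m.

Definition ideal_mul I J : set R :=
  [set x | exists (n : nat) (a b : 'I_n -> R),
     [/\ forall i, I (a i), forall i, J (b i) & x = \sum_(i < n) a i * b i]].

Definition ideal_exp I (k : nat) : set R := iter k (ideal_mul I) setT.

Definition annihilator x : set R := [set r | r * x = 0].

Definition principal x : set R := [set r | exists a, r = a * x].

Definition exact_zero_divisor x : Prop :=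
  [/\ x \isn't a GRing.unit, x != 0 &
      exists w, annihilator x = principal w /\ annihilator w = principal x].

End Rings.

Section Modules.
Variable R : comUnitRingType.
Implicit Types M N F : lmodType R.

Definition isomorphic M N : Prop := exists f : {linear M -> N}, bijective f.

Definition exact_at (A B C : lmodType R) (f : A -> B) (g : B -> C) : Prop :=
  forall x, g x = 0 <-> exists y, f y = x.

Definition finitely_generated M : Prop :=
  exists (n : nat) (g : 'I_n -> M),
    forall x, exists c : 'I_n -> R, x = \sum_(i < n) c i *: g i.

Definition fg_free F : Prop := exists n : nat, isomorphic F 'rV[R]_n.

(* M is isomorphic to Coker f, via the map induced by p. *)
Definition is_cokernel (A B : lmodType R) (f : A -> B) M : Prop :=
  exists p : {linear B -> M}, (forall x, exists y, p y = x) /\ exact_at f p.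

(* A free summand of a finitely generated module is finitely generated, so for
   the modules considered here [fg_free] covers all free summands. *)
Definition without_free_summands M : Prop :=
  ~ exists F N : lmodType R,
      [/\ fg_free F, exists x : F, x != 0 & isomorphic M (F * N)%type].

(* [d i] is the map F_{i+1} -> F_i; since i ranges over all integers, so
   does i + 1, and exactness is required at every spot of the sequence. *)
Definition exact_complex (F : int -> lmodType R)
    (d : forall i : int, {linear F (i + 1) -> F i}) : Prop :=
  forall i : int, exact_at (d (i + 1)) (d i).

(* Exactness of Hom(F, R) at Hom(F_{i+1}, R):
   a functional on F_{i+1} is killed by precomposition with d_{i+1} if and
   only if it is the composite of d_i with a functional on F_i. *)
Definition exact_dual_complex (F : int -> lmodType R)
    (d : forall i : int, {linear F (i + 1) -> F i}) : Prop :=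
  forall (i : int) (f : {linear F (i + 1) -> R^o}),
    (forall x, f (d (i + 1) x) = 0) <->
    exists g : {linear F i -> R^o}, forall y, g (d i y) = f y.

Definition totally_reflexive M : Prop :=
  finitely_generated M /\
  exists (F : int -> lmodType R)
         (d : forall i : int, {linear F (i + 1) -> F i}),
    [/\ forall i, fg_free (F i), exact_complex d, exact_dual_complex d &
        is_cokernel (d 0) M].

(* An n x m matrix gives the map R^m -> R^n, v |-> Psi v, on column vectors. *)
Definition presented_by M (n m : nat) (Psi : 'M[R]_(n, m)) : Prop :=
  is_cokernel (fun v : 'cV[R]_m => Psi *m v : 'cV[R]_n) M.

(* The presentation R^m -> R^n -> Coker Psi -> 0 over a local ring with
   maximal ideal mm is minimal: im Psi is contained in mm R^n and ker Psi
   in mm R^m.  Without this, 1 x 1 blocks (1) and redundant columns could be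
   added to the presentation of any module. *)
Definition minimal_matrix (mm : set R) (n m : nat) (Psi : 'M[R]_(n, m)) : Prop :=
  (forall i j, mm (Psi i j)) /\
  (forall v : 'cV[R]_m, Psi *m v = 0 -> forall j, mm (v j 0)).

Definition injective_module M : Prop :=
  forall (A B : lmodType R) (u : {linear A -> B}) (f : {linear A -> M}),
    injective u -> exists g : {linear B -> M}, forall x, g (u x) = f x.

(* M has an injective resolution 0 -> M -> I_0 -> I_1 -> ... whose terms
   vanish beyond some degree. *)
Definition finite_injective_dimension M : Prop :=
  exists (I : nat -> lmodType R) (e : {linear M -> I 0%N})
         (d : forall i, {linear I i -> I i.+1}),
    [/\ forall i, injective_module (I i),
        injective e, exact_at e (d 0%N),
        forall i, exact_at (d i) (d i.+1) &
        exists n, forall i, (n < i)%N -> forall x : I i, x = 0].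

End Modules.

(* For a noetherian local ring. *)
Definition gorenstein (R : comUnitRingType) : Prop :=
  finite_injective_dimension (R^o : lmodType R).

(* Main.v *)
Require Import Defs.
From HB Require Import structures.
From mathcomp Require Import all_boot all_order all_algebra.
From mathcomp Require Import boolp classical_sets.
From mathcomp Require Import ring zify.

Set Implicit Arguments.
Unset Strict Implicit.
Unset Printing Implicit Defensive.

Import GRing.Theory.

Local Open Scope classical_set_scope.
Local Open Scope ring_scope.

(** Let [S] be the socle of [R], [e] the dimension of [mm/S] and [r] that of
    [S] over the residue field; [mm mm <= S] because [mm^3 = 0].

    The key fact is that in a totally exact sequence (exact with exact dual) of
    matrices with entries in [mm], each matrix [A : R^m -> R^n] maps [mm^m] onto
    [S^n] ([totally_exact_covers_socle]).  Indeed [S^n] is killed by the next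
    matrix, so it lies in [im A]; if [A w] were in [S^n] with [w] outside [mm^m],
    the residue field would be a direct summand of [im A], hence
    [Ext^1(R/mm, R) = 0], and [R] would be self-injective ([baer_injective])
    and so Gorenstein.

    Counting dimensions then gives [e b_i = r b_(i-1) + b_(i+1)] for the ranks
    [b_i] of the free modules ([betti_relation]).  The dual sequence satisfies
    the same hypotheses, so also [e b_i = r b_(i+1) + b_(i-1)].  Since [R] is
    not Gorenstein, [r >= 2] ([socle_dim1_extend]); the two relations force
    the ranks to be constant and [e = r + 1].

    Suppose that [x] is the only nonzero entry of the [i]-th row of a matrix
    [A] of such a sequence, in column [j] ([single_entry_row]).  As [A] covers
    the socle, [S = x mm].  The entries of the [j]-th row of the next matrix
    kill [x], and not all of them lie in [S], since that matrix also covers the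
    socle.  Let [w] be such an entry outside [S].  Comparing dimensions,
    [(0 : x) = (w) + S]; this yields [S = w mm], so [(0 : x) = (w)] and, by
    symmetry, [(0 : w) = (x)].  The column case is the row case for the
    transposed sequence.

    It remains to embed the given presentation in a totally exact sequence with
    entries in [mm].  On either side of [Psi] such a sequence is built by
    choosing minimal generators of kernels; its dual exactness is inherited
    from the given complete resolution, which need not be minimal, by
    comparing the two resolutions up to homotopy ([prolongs_comparable]).  On the
    dual side this requires the kernel of [Psi^T] to lie in [mm^n], which holds
    because the module has no free summand ([no_free_summand_kernel]). *)

(** * Local rings whose maximal ideal has cube zero *)

(** The situation of the theorem in elementary terms: [mm] is an ideal, it
    consists of the non-units, and the product of any three of its elements
    vanishes. *)
Definition cube_zero_local (R : comUnitRingType) (mm : set R) : Prop :=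
  [/\ is_ideal mm, forall a, mm a <-> a \isn't a GRing.unit &
      forall a b c, mm a -> mm b -> mm c -> a * b * c = 0].

(** The socle of [R]: the elements killed by [mm]. *)
Definition socle (R : comUnitRingType) (mm : set R) : set R :=
  [set s | forall r, mm r -> r * s = 0].

(** [h] restricts to an [R]-linear map [mm -> R]; its values outside [mm] are
    irrelevant. *)
Definition linear_on (R : comUnitRingType) (mm : set R) (h : R -> R) : Prop :=
  forall r a b, mm a -> mm b -> h (r * a + b) = r * h a + h b.

(** Every [R]-linear map [mm -> R] is multiplication by an element of [R];
    equivalently, [Ext^1(R/mm, R) = 0]. *)
Definition maximal_maps_extend (R : comUnitRingType) (mm : set R) : Prop :=
  forall h : R -> R, linear_on mm h ->
    exists c, forall r, mm r -> h r = r * c.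

Lemma local_ring_cube_zero (R : comUnitRingType) (mm : set R) :
  local_ring mm -> ideal_exp mm 3 = [set 0] -> cube_zero_local mm.
Proof.
move=> [[[mm0 mmL] mmT mmmax] _] mm3.
have idmm : is_ideal mm by [].
have prod3 a b c : mm a -> mm b -> mm c -> a * b * c = 0.
  move=> ma mb mc.
  have single I J x y : I x -> J y -> @ideal_mul R I J (x * y).
    move=> Ix Jy; exists 1%N, (fun=> x), (fun=> y); split=> //.
    by rewrite big_ord1.
  have : ideal_exp mm 3 (a * (b * (c * 1))).
    by do 3!apply: (single) => //.
  by rewrite mm3 /= mulr1 mulrA.
have mmM r a : mm a -> mm (r * a).
  by move=> ma; rewrite -[_ * _]addr0; apply: mmL.
have nunit a : mm a -> a \isn't a GRing.unit.
  move=> ma; apply/negP => ua; apply/negP: mmT; rewrite negbK; apply/eqP.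
  apply/seteqP; split=> // r _.
  by rewrite -[r](divrK ua); apply: mmM.
split=> // a; split; first exact: nunit.
move=> nua; apply: contrapT => nma.
(* a element outside [mm] generates the unit ideal together with [mm] *)
have idI : is_ideal [set y | exists u b, mm u /\ y = u + b * a].
  split; first by exists 0, 0; rewrite mul0r addr0.
  move=> r x y [u [b [mu ->]]] [v [c [mv ->]]].
  exists (r * u + v), (r * b + c); split; first exact: mmL.
  ring.
case: (mmmax _ idI); first by move=> u mu; exists u, 0; rewrite mul0r addr0.
  move=> E; apply: nma; rewrite -E; exists 0, 1; split=> //.
  by rewrite add0r mul1r.
move=> E; have : [set: R] 1 by [].
rewrite -E => -[u [b [mu e1]]].
move/negP: nua; apply; apply/unitrPr.
exists (b * (1 + u + u * u)).
have -> : a * (b * (1 + u + u * u)) = (b * a) * (1 + u + u * u) by ring.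
have -> : b * a = 1 - u by rewrite e1; ring.
have -> : (1 - u) * (1 + u + u * u) = 1 - u * u * u by ring.
by rewrite prod3 // subr0.
Qed.

Section CubeZeroLocal.
Context (R : comUnitRingType) (mm : set R) (mmP : cube_zero_local mm).

Lemma max0 : mm 0. Proof. by case: mmP => -[]. Qed.

Lemma maxMl r a : mm a -> mm (r * a).
Proof. by case: mmP => -[m0 mL] _ _ ma; rewrite -[_ * _]addr0; apply: mL. Qed.

Lemma maxD a b : mm a -> mm b -> mm (a + b).
Proof. by case: mmP => -[m0 mL] _ _ ma mb; rewrite -[a]mul1r; apply: mL. Qed.

Lemma maxN a : mm a -> mm (- a).
Proof. by rewrite -mulN1r; apply: maxMl. Qed.

Lemma max_sum (I : finType) (F : I -> R) :
  (forall i, mm (F i)) -> mm (\sum_i F i).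
Proof. by move=> mF; apply: big_ind => //; [apply: max0 | apply: maxD]. Qed.

Lemma max3 a b c : mm a -> mm b -> mm c -> a * b * c = 0.
Proof. by case: mmP => _ _; apply. Qed.

Lemma max_nonunit a : mm a <-> a \isn't a GRing.unit.
Proof. by case: mmP. Qed.

Lemma not_max a : ~ mm a -> a \is a GRing.unit.
Proof. by move=> nma; apply/negPn/negP => /max_nonunit. Qed.

Lemma socMl r s : socle mm s -> socle mm (r * s).
Proof. by move=> ss t mt; rewrite mulrCA ss ?mulr0. Qed.

Lemma soc0 : socle mm 0. Proof. by move=> t _; rewrite mulr0. Qed.

Lemma socD s t : socle mm s -> socle mm t -> socle mm (s + t).
Proof. by move=> ss st r mr; rewrite mulrDr ss ?st ?addr0. Qed.

Lemma socN s : socle mm s -> socle mm (- s).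
Proof. by move=> ss r mr; rewrite mulrN ss ?oppr0. Qed.

Lemma socB s t : socle mm s -> socle mm t -> socle mm (s - t).
Proof. by move=> ss st; apply: socD => //; apply: socN. Qed.

Lemma soc_sum (I : finType) (F : I -> R) :
  (forall i, socle mm (F i)) -> socle mm (\sum_i F i).
Proof. by move=> sF; apply: big_ind => //; [apply: soc0 | apply: socD]. Qed.

Lemma soc_prod a b : mm a -> mm b -> socle mm (a * b).
Proof. by move=> ma mb r mr; rewrite mulrA max3. Qed.

Lemma soc_ideal : is_ideal (socle mm).
Proof. by split=> [|a x y sx sy]; [apply: soc0 | apply/socD/sy/socMl]. Qed.

Lemma unit_soc u s : u \is a GRing.unit -> socle mm (u * s) -> socle mm s.
Proof. by move=> uu /(socMl u^-1); rewrite mulKr. Qed.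

(** * Self-injectivity *)

(** Baer's criterion, in the form that suits a nilpotent maximal ideal: linear
    maps only have to be extended from [mm] to [R].  A maximal partial
    extension, given by its graph, is everywhere defined: otherwise some [z]
    outside its domain satisfies [mm z <= domain], because [mm^3 = 0]. *)
Lemma baer_injective : maximal_maps_extend mm -> injective_module R^o.
Proof.
move=> ext A B u f injf.
(* graphs of linear maps from a submodule of [B] that extend [f] along [u] *)
pose good (G : set (B * R)) :=
  [/\ forall r p q, G p -> G q -> G (r *: p.1 + q.1, r * p.2 + q.2),
      forall y, G (0, y) -> y = 0 & forall a, G (u a, f a)].
have good_fun G : good G -> forall b y y', G (b, y) -> G (b, y') -> y = y'.
  move=> [GL G0 _] b y y' Gy Gy'; apply/eqP; rewrite -subr_eq0; apply/eqP.
  by apply: G0; have := GL (-1) _ _ Gy' Gy; rewrite /= scaleN1r addNr mulN1r addrC.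
pose base : set (B * R) := [set p | exists a, p = (u a, f a)].
have good_base : good base.
  split.
  - move=> r _ _ [a ->] [b ->] /=; exists (r *: a + b).
    by rewrite !linearP.
  - move=> y [a [/esym ua0 ->]].
    have -> : a = 0 by apply: injf; rewrite ua0 linear0.
    by rewrite linear0.
  - by move=> a; exists a.
(* the empty set is admitted so that the union of the empty chain qualifies *)
have [|G [PG Gmax]] := @Zorn_bigcup _ [set G | G = set0 \/ good G].
  move=> F FP Ftot; have [F0|] := pselect (exists2 X, F X & good X); last first.
    move=> nF; left; rewrite -subset0 => p [X FX Xp].
    have [X0|gX] := FP _ FX; first by move: Xp; rewrite X0.
    by case: nF; exists X.
  have [X0 FX0 gX0] := F0; right; split.
  - move=> r p q [X FX Xp] [Y FY Yq].
    have gX : good X by case: (FP _ FX) => // E; move: Xp; rewrite E.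
    have gY : good Y by case: (FP _ FY) => // E; move: Yq; rewrite E.
    have [XY|YX] := Ftot _ _ FX FY.
      by exists Y => //; case: gY => gL _ _; apply: gL => //; apply: XY.
    by exists X => //; case: gX => gL _ _; apply: gL => //; apply: YX.
  - move=> y [X FX Xy].
    have gX : good X by case: (FP _ FX) => // E; move: Xy; rewrite E.
    by case: gX => _ g0 _; apply: g0.
  - by move=> a; exists X0 => //; case: gX0.
have gG : good G.
  case: PG => // G0; exfalso; apply: (Gmax base); last by right.
  rewrite G0; split=> [|sb]; first by move=> ? [].
  by apply: (sb (u 0, f 0)); exists 0.
have [GL G0 GB] := gG.
pose dom b := exists y, G (b, y).
have domL r b c : dom b -> dom c -> dom (r *: b + c).
  by move=> [y Gy] [z Gz]; exists (r * y + z); apply: (GL _ (b, y) (c, z)).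
have dom0 : dom 0 by exists (f 0); rewrite -(linear0 u); apply: GB.
have domZ r b : dom b -> dom (r *: b).
  by move=> db; rewrite -[_ *: _]addr0; apply: domL.
have domT z : dom z.
  apply: contrapT => ndz.
  (* [z'] is [z], [r z] or [s r z] with [r], [s] in [mm], as [mm^3 = 0] *)
  have [z' ndz' mz'] : exists2 z', ~ dom z' & forall r, mm r -> dom (r *: z').
    have step w : (forall r, mm r -> dom (r *: w)) \/
        exists2 r, mm r & ~ dom (r *: w).
      have [h|h] := pselect (exists2 r, mm r & ~ dom (r *: w)).
        by right.
      by left=> r mr; apply: contrapT => nd; apply: h; exists r.
    have [?|[r mr nr]] := step z; first by exists z.
    have [?|[s ms ns]] := step (r *: z); first by exists (r *: z).
    exists (s *: (r *: z)) => // t mt.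
    by rewrite !scalerA max3 // scale0r.
  pose h r : R := xget 0 [set y | G (r *: z', y)].
  have hP r : mm r -> G (r *: z', h r).
    move=> /mz' [y Gy].
    by apply: (@xgetPex _ _ [set y | G (r *: z', y)]); exists y.
  have hL : linear_on mm h.
    move=> r a b ma mb; apply: (good_fun _ gG ((r * a + b) *: z')).
      by apply: hP; apply: maxD => //; apply: maxMl.
    by have := GL r _ _ (hP _ ma) (hP _ mb); rewrite /= scalerA -scalerDl.
  have [c hc] := ext _ hL.
  have gz a : mm a -> G (a *: z', a * c) by move=> ma; rewrite -hc //; apply: hP.
  pose G' : set (B * R) :=
    [set p | exists b y a, G (b, y) /\ p = (b + a *: z', y + a * c)].
  have G00 : G (0, 0) by rewrite -(linear0 u) -(linear0 f); apply: GB.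
  apply: (Gmax G'); last first.
    right; split.
    - move=> r _ _ [b [y [a [Gby ->]]]] [b' [y' [a' [Gby' ->]]]] /=.
      exists (r *: b + b'), (r * y + y'), (r * a + a').
      split; first exact: (GL r (b, y) (b', y')).
      by congr (_, _); [rewrite scalerDr scalerA scalerDl addrACA | ring].
    - move=> y0 [b [y [a [Gby [/esym e1 ->]]]]].
      have eb : b = (- a) *: z'.
        by apply/eqP; rewrite scaleNr -addr_eq0 e1.
      have [ma|nma] := pselect (mm a).
        have := gz _ (maxN ma); rewrite -eb => /(good_fun _ gG _ _ _ Gby) ->.
        ring.
      exfalso; apply: ndz'; have ua := not_max nma.
      have : dom (- a^-1 *: b) by apply: domZ; exists y.
      by rewrite eb scalerA mulrNN mulVr // scale1r.
    - move=> a; exists (u a), (f a), 0; split; first exact: GB.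
      by rewrite scale0r mul0r !addr0.
  split=> [[b y] Gby|sub].
    by exists b, y, 0; rewrite scale0r mul0r !addr0.
  apply: ndz'; exists c; apply: sub; exists 0, 0, 1.
  by rewrite scale1r mul1r !add0r.
pose g b : R^o := xget 0 [set y | G (b, y)].
have gP b : G (b, g b).
  by have [y Gy] := domT b; apply: (@xgetPex _ _ [set y | G (b, y)]); exists y.
have glin : linear g.
  move=> r b c; apply: (good_fun _ gG (r *: b + c)) => //.
  exact: (GL r _ _ (gP b) (gP c)).
pose gM := GRing.isLinear.Build _ _ _ _ g glin.
pose gl : {linear B -> R^o} := HB.pack g gM.
by exists gl => a; apply: (good_fun _ gG (u a)) => //; apply: gP.
Qed.

(** [0 -> R -> R -> 0] is an injective resolution of [R]. *)
Lemma extend_gorenstein : maximal_maps_extend mm -> gorenstein R.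
Proof.
move=> ext.
pose I i : lmodType R := if i is 0%N then R^o else 'rV[R]_0.
have triv i (x : I i.+1) : x = 0 by apply/rowP => -[].
exists I, (idfun : {linear R^o -> R^o}),
  (fun i => [the {linear I i -> I i.+1} of \0]).
split.
- case=> [|i]; first exact: baer_injective.
  move=> A B u f _; exists [the {linear B -> I i.+1} of \0] => a.
  by rewrite (triv _ (f a)).
- by [].
- by move=> x; split=> _ //; exists x.
- move=> i x; split=> _ //; exists 0; rewrite (triv _ x); exact: linear0.
- by exists 0%N; case=> // i _; apply: triv.
Qed.

End CubeZeroLocal.

(** * Bases of semisimple subquotients *)

Definition submodule (R : comUnitRingType) (V : lmodType R) (N : set V) : Prop :=
  N 0 /\ forall a x y, N x -> N y -> N (a *: x + y).

Lemma sum_enum_val (I : finType) (W : zmodType) (F : I -> W) :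
  \sum_i F i = \sum_(a < #|I|) F (enum_val a).
Proof. by rewrite -big_enum_val. Qed.

Lemma sum_option (I : finType) (W : zmodType) (F : option I -> W) :
  \sum_o F o = F None + \sum_i F (Some i).
Proof.
rewrite (bigD1 None) //=; congr (_ + _).
rewrite (reindex_omap Some id) //=; last by case.
by apply: eq_bigl => i; rewrite eqxx.
Qed.

Section ResidueBasis.
Context (R : comUnitRingType) (mm : set R) (mmP : cube_zero_local mm).
Context (V : lmodType R) (P N : set V).

(** The members of the family [g] lie in [P] and span [P] modulo [N]. *)
Definition spans_mod (I : finType) (g : I -> V) : Prop :=
  (forall i, P (g i)) /\
  forall v, P v -> exists c : I -> R, N (v - \sum_i c i *: g i).

(** [g] is linearly independent over [R/mm], modulo [N]. *)
Definition indep_mod (I : finType) (g : I -> V) : Prop :=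
  forall c : I -> R, N (\sum_i c i *: g i) -> forall i, mm (c i).

(** If [mm P <= N <= P], then [P/N] is a vector space over the residue field;
    [g] induces a basis of it.  Coefficients are kept in [R]. *)
Definition residue_basis (I : finType) (g : I -> V) : Prop :=
  spans_mod g /\ indep_mod g.

Context (subN : submodule N).
Context (mPN : forall a v, mm a -> P v -> N (a *: v)).

Lemma submod0 : N 0. Proof. by case: subN. Qed.

Lemma submodZ a v : N v -> N (a *: v).
Proof. by case: subN => N0 NL Nv; rewrite -[_ *: _]addr0; apply: NL. Qed.

Lemma submodD v w : N v -> N w -> N (v + w).
Proof. by case: subN => N0 NL Nv Nw; rewrite -[v]scale1r; apply: NL. Qed.

Lemma submodN v : N v -> N (- v).
Proof. by rewrite -scaleN1r; apply: submodZ. Qed.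

Lemma submod_sum (I : finType) (F : I -> V) :
  (forall i, N (F i)) -> N (\sum_i F i).
Proof. by move=> NF; apply: big_ind => //; [apply: submod0 | apply: submodD]. Qed.

(** Substituting one linear expansion into another. *)
Lemma comb_subst (I J : finType) (u : V) (c : J -> R) (g : J -> V)
    (d : J -> I -> R) (k : I -> V) :
  u - \sum_x (\sum_j c j * d j x) *: k x =
  (u - \sum_j c j *: g j) + \sum_j c j *: (g j - \sum_x d j x *: k x).
Proof.
have -> : \sum_j c j *: (g j - \sum_x d j x *: k x) =
    \sum_j c j *: g j - \sum_j c j *: \sum_x d j x *: k x.
  by rewrite -sumrB; apply: eq_bigr => j _; rewrite scalerBr.
rewrite addrA subrK; congr (_ - _).
under eq_bigr do rewrite scaler_suml.
rewrite exchange_big /=; apply: eq_bigr => j _.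
by rewrite scaler_sumr; apply: eq_bigr => x _; rewrite scalerA.
Qed.

(** The transition matrices [X], [Y] satisfy [X Y = 1 - E] with [E] over [mm],
    hence [E^3 = 0] and [X] has a right inverse over [R]. *)
Lemma residue_basis_le (I J : finType) (g : I -> V) (g' : J -> V) :
  residue_basis g -> spans_mod g' -> (#|I| <= #|J|)%N.
Proof.
move=> [[Pg sg] ig] [Pg' sg'].
have [X hX] := choice (fun i => sg' _ (Pg i)).
have [Y hY] := choice (fun j => sg _ (Pg' j)).
have hD i k : mm ((i == k)%:R - \sum_j X i j * Y j k).
  move: k; apply: ig => /=.
  have -> : \sum_k ((i == k)%:R - \sum_j X i j * Y j k) *: g k =
     (g i - \sum_j X i j *: g' j) +
     \sum_j X i j *: (g' j - \sum_k Y j k *: g k).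
    rewrite -comb_subst; under eq_bigr do rewrite scalerBl.
    rewrite sumrB (bigD1 i) //= eqxx scale1r big1 ?addr0 //.
    by move=> k /negPf ki; rewrite eq_sym ki scale0r.
  apply: submodD; first exact: hX.
  by apply: submod_sum => j; apply: submodZ; apply: hY.
pose XM := \matrix_(a < #|I|, b < #|J|) X (enum_val a) (enum_val b).
pose YM := \matrix_(b < #|J|, a < #|I|) Y (enum_val b) (enum_val a).
pose E := 1%:M - XM *m YM.
have mE a b : mm (E a b).
  rewrite /E !mxE; under eq_bigr do rewrite !mxE.
  have -> : (a == b) = (enum_val a == enum_val b :> I).
    by rewrite (inj_eq enum_val_inj).
  rewrite -(sum_enum_val (fun j => X (enum_val a) j * Y j (enum_val b))).
  exact: hD.
have E3 : E *m E *m E = 0.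
  apply/matrixP => a b; rewrite !mxE; apply: big1 => c _.
  rewrite mxE mulr_suml; apply: big1 => d _.
  exact: (max3 mmP).
have XY : XM *m YM = 1%:M - E by rewrite /E opprB addrC subrK.
move: (E) XY E3 => {mE}E' XY E3.
apply: (@mulmx1_min _ _ _ XM (YM *m (1%:M + E' + E' *m E'))).
rewrite mulmxA XY mulmxBl mul1mx !mulmxDr mulmx1 (mulmxA E' E' E') E3 addr0.
by rewrite -[X in X - _]addrA addrK.
Qed.

Lemma residue_basis_card (I J : finType) (g : I -> V) (g' : J -> V) :
  residue_basis g -> residue_basis g' -> #|I| = #|J|.
Proof.
move=> bg bg'; apply/eqP; rewrite eqn_leq.
by rewrite (residue_basis_le bg bg'.1) (residue_basis_le bg' bg.1).
Qed.

(** The family [g] with the vector [v] adjoined at the index [None]. *)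
Definition family_cons (I : finType) (g : I -> V) (v : V) (o : option I) : V :=
  if o is Some i then g i else v.

Lemma indep_cons (I : finType) (g : I -> V) (v : V) :
  (forall i, P (g i)) -> P v -> indep_mod g ->
  ~ (exists c : I -> R, N (v - \sum_i c i *: g i)) ->
  indep_mod (family_cons g v).
Proof.
move=> Pg Pv ig nv c; rewrite sum_option /= => Nc.
have mc0 : mm (c None).
  apply: contrapT => /(not_max mmP) uc; apply: nv.
  exists (fun i => - ((c None)^-1 * c (Some i))).
  have := submodZ (c None)^-1 Nc.
  rewrite scalerDr scalerA mulVr // scale1r scaler_sumr -sumrN.
  by under [in X in _ -> X]eq_bigr do rewrite scaleNr opprK -scalerA.
case=> [i|//]; move: i; apply: ig.
rewrite -[X in N X](addKr (c None *: v)).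
by apply: submodD => //; apply/submodN/mPN.
Qed.

(** The existence half of the exchange argument: members of the spanning family
    [g] are adjoined to [v] until the result spans. *)
Lemma basis_extend (I J : finType) (v : I -> V) (g : J -> V) :
  (forall i, P (v i)) -> indep_mod v -> spans_mod g ->
  exists (K : finType) (k : K -> V), residue_basis k /\ (#|I| <= #|K|)%N.
Proof.
move=> Pv iv [Pg sg].
have H (s : seq J) : exists (K : finType) (k : K -> V),
    [/\ (#|I| <= #|K|)%N, forall x, P (k x), indep_mod k &
        forall j, j \in s -> exists c : K -> R, N (g j - \sum_x c x *: k x)].
  elim: s => [|j s [K [k [IK Pk ik sk]]]]; first by exists I, v; split.
  have [dj|ndj] := pselect (exists c : K -> R, N (g j - \sum_x c x *: k x)).
    exists K, k; split=> // j'; rewrite inE => /orP[/eqP ->//|]; exact: sk.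
  exists (option K), (family_cons k (g j)); split.
  - by rewrite card_option ltnW.
  - by case=> [x|] /=.
  - exact: indep_cons.
  - move=> j'; rewrite inE => /orP[/eqP ->|/sk [c Nc]].
      exists (fun o => if o is None then 1 else 0).
      rewrite sum_option /= scale1r big1 ?addr0 ?subrr; first exact: submod0.
      by move=> x _; rewrite scale0r.
    exists (fun o => if o is Some x then c x else 0).
    by rewrite sum_option /= scale0r add0r.
have [K [k [IK Pk ik sk]]] := H (enum J).
have {}sk j : exists c : K -> R, N (g j - \sum_x c x *: k x).
  by apply: sk; rewrite mem_enum.
exists K, k; split=> //; split=> //; split=> // u Pu.
have [c Nc] := sg _ Pu; have [d hd] := choice sk.
exists (fun x => \sum_j c j * d j x).
rewrite (comb_subst _ _ g).
by apply: submodD => //; apply: submod_sum => j; apply: submodZ.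
Qed.

(** An independent family with as many members as a basis is spanning. *)
Lemma indep_card_spans (I J : finType) (v : I -> V) (g : J -> V) :
  residue_basis g -> (forall i, P (v i)) -> indep_mod v -> #|I| = #|J| ->
  spans_mod v.
Proof.
move=> bg Pv iv IJ; split=> // u Pu; apply: contrapT => nu.
have [|K [k [bk]]] := basis_extend _ (indep_cons Pv Pu iv nu) bg.1.
  by case.
by rewrite card_option IJ (residue_basis_card bg bk) ltnn.
Qed.

End ResidueBasis.

Section IdealBases.
Context (R : comUnitRingType) (mm : set R) (mmP : cube_zero_local mm).

(** In a noetherian ring [I/J] has a finite basis if [mm I <= J]. *)
Lemma ideal_basis (I J : set R) : noetherian R -> is_ideal I -> is_ideal J ->
  (forall a v, mm a -> I v -> J (a * v)) ->
  exists (n : nat) (g : 'I_n -> R), @residue_basis R mm R^o I J 'I_n g.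
Proof.
move=> noeth idI idJ mIJ.
have [n [g gI]] := noeth _ idI.
have Ig k : I (g k).
  rewrite gI; exists (fun l => (l == k)%:R).
  rewrite (bigD1 k) //= eqxx mul1r big1 ?addr0 // => l /negPf lk.
  by rewrite lk mul0r.
have sg : @spans_mod R R^o I J 'I_n g.
  split=> // v; rewrite {1}gI => -[c ->]; exists c.
  by rewrite subrr; case: idJ.
have [|c _ []//|K [k [[[Ik sk] ik] _]]] :=
  @basis_extend R mm mmP R^o I J idJ mIJ 'I_0 'I_n (fun=> 0) g _ _ sg.
  by case.
exists #|K|, (fun a => k (enum_val a)); split; first split.
- by move=> a; apply: Ik.
- move=> v /sk [c Jc]; exists (fun a => c (enum_val a)).
  by rewrite -(sum_enum_val (fun x => c x *: (k x : R^o))).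
- move=> c Jc a; rewrite -(enum_valK a).
  apply: (ik (fun x => c (enum_rank x))).
  rewrite (sum_enum_val (fun x => c (enum_rank x) *: (k x : R^o))) /=.
  by under eq_bigr do rewrite enum_valK.
Qed.

(** Column vectors all of whose entries lie in [I]. *)
Definition col_set (I : set R) (b : nat) : set 'cV[R]_b :=
  [set v | forall i, I (v i 0)].

Lemma col_set_submodule (I : set R) b : is_ideal I -> submodule (@col_set I b).
Proof.
move=> [I0 IL]; split=> [i|a v w Iv Iw i]; rewrite !mxE //.
exact: IL.
Qed.

Lemma col_sum_delta b (v : 'cV[R]_b) : v = \sum_i v i 0 *: delta_mx i 0.
Proof.
apply/colP => i; rewrite summxE (bigD1 i) //= big1 ?addr0.
  by rewrite !mxE !eqxx mulr1.
by move=> j /negPf ji; rewrite !mxE eq_sym ji mulr0.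
Qed.

(** A basis of [I/J] gives one of [I^b/J^b]. *)
Lemma col_basis (I J : set R) (K : finType) (g : K -> R) (b : nat) :
  is_ideal I -> is_ideal J ->
  @residue_basis R mm R^o I J K g ->
  residue_basis mm (@col_set I b) (@col_set J b)
    (fun p : K * 'I_b => g p.1 *: (delta_mx p.2 0 : 'cV[R]_b)).
Proof.
move=> [I0 IL] [J0 JL] [[Ig sg] ig].
have E (c : K * 'I_b -> R) i :
    (\sum_p c p *: (g p.1 *: (delta_mx p.2 0 : 'cV[R]_b))) i 0 =
    \sum_k c (k, i) * g k.
  rewrite summxE.
  pose F k l := (c (k, l) *: (g k *: (delta_mx l 0 : 'cV[R]_b))) i 0.
  transitivity (\sum_p F p.1 p.2); first by apply: eq_bigr => -[].
  rewrite -pair_bigA /F /=.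
  apply: eq_bigr => k _; rewrite (bigD1 i) //= big1 ?addr0.
    by rewrite !mxE !eqxx mulr1.
  by move=> j /negPf ji; rewrite !mxE eq_sym ji !mulr0.
split; first split.
- move=> [k i] l; rewrite !mxE /= mulrC.
  by rewrite -[_ * _]addr0; apply: IL.
- move=> v Iv.
  have [c hc] := choice (fun i => sg _ (Iv i)).
  exists (fun p => c p.2 p.1) => i; rewrite mxE [X in _ + X]mxE E /=.
  exact: hc.
- move=> c hc [k i]; apply: (ig (fun k => c (k, i))).
  by have := hc i; rewrite E.
Qed.

End IdealBases.

(** * Linear maps from the maximal ideal to the ring *)

Section MapsOnMax.
Context (R : comUnitRingType) (mm : set R) (mmP : cube_zero_local mm).
Context (h : R -> R) (hL : linear_on mm h).

Lemma linear_on0 : h 0 = 0.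
Proof.
have m0 := max0 mmP.
by have := hL (-1) m0 m0; rewrite mulr0 addr0 mulN1r addNr.
Qed.

Lemma linear_onZ r a : mm a -> h (r * a) = r * h a.
Proof.
move=> ma; rewrite -[r * a]addr0 hL ?linear_on0 ?addr0 //; exact: (max0 mmP).
Qed.

Lemma linear_onD a b : mm a -> mm b -> h (a + b) = h a + h b.
Proof. by move=> ma mb; rewrite -[a]mul1r hL // !mul1r. Qed.

Lemma linear_on_sum (I : finType) (c a : I -> R) :
  (forall i, mm (a i)) -> h (\sum_i c i * a i) = \sum_i c i * h (a i).
Proof.
move=> ma; suff [] : mm (\sum_i c i * a i) /\
    h (\sum_i c i * a i) = \sum_i c i * h (a i) by [].
apply: (big_ind2 (fun x y => mm x /\ h x = y)).
- by split; [apply: (max0 mmP) | apply: linear_on0].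
- move=> x hx y hy [mx ex] [my ey]; split; first exact: (maxD mmP).
  by rewrite linear_onD // ex ey.
- by move=> i _; split; [apply: (maxMl mmP) | apply: linear_onZ].
Qed.

End MapsOnMax.

(** If the socle [S] has dimension one, then multiplication makes [mm/S] its
    own dual with values in [S], so every linear map [mm -> R] is
    multiplication by an element.  Hence [S] has dimension at least two if [R]
    is not Gorenstein. *)
Lemma socle_dim1_extend (R : comUnitRingType) (mm : set R) (e : nat)
    (xs : 'I_e -> R) (ss : 'I_1 -> R) :
  cube_zero_local mm ->
  (forall s, socle mm s -> mm s) ->
  @residue_basis R mm R^o mm (socle mm) 'I_e xs ->
  @residue_basis R mm R^o (socle mm) [set 0] 'I_1 ss ->
  maximal_maps_extend mm.
Proof.
move=> mmP smm bx bs h hL.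
have [[mx sx] ix] := bx; have [[sS sps] _] := bs.
have idm : is_ideal mm by case: mmP.
have id0 : is_ideal [set 0 : R] by split=> // a _ _ -> ->; rewrite mulr0 addr0.
set s := ss ord0.
have S1 t : socle mm t -> exists d, t = d * s.
  move=> /sps [c]; rewrite big_ord1 => /= /eqP; rewrite subr_eq0 => /eqP ->.
  by exists (c ord0).
have ms : mm s by apply/smm/sS.
(* subtracting a multiplication from [h] gives [h'], which vanishes on [S] *)
have [c hc] : exists c, h s = c * s.
  by apply: S1 => a ma; rewrite -(linear_onZ mmP hL) // sS // (linear_on0 mmP hL).
pose h' a := h a - c * a.
have h'L : linear_on mm h' by move=> r a b ma mb; rewrite /h' hL //; ring.
have h'S t : socle mm t -> h' t = 0.
  move=> /S1 [d ->]; rewrite (linear_onZ mmP h'L) // /h' hc; ring.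
have h's a : mm a -> socle mm (h' a).
  move=> ma r mr; rewrite -(linear_onZ mmP h'L) // h'S //.
  exact: (soc_prod mmP).
(* [v b] represents the functional [xs b * _] on [mm/S]; the [v b] are
   independent, since an element of [mm] killing [mm] lies in [S], and there
   are as many of them as the dimension of [S^e] *)
pose v b : 'cV[R]_e := \col_a (xs b * xs a).
have E (d : 'I_e -> R) a : (\sum_b d b *: v b) a 0 = (\sum_b d b * xs b) * xs a.
  rewrite summxE mulr_suml; apply: eq_bigr => b _.
  by rewrite !mxE mulrA.
have iv : indep_mod mm (@col_set R [set 0] e) v.
  move=> d hd; apply: ix => t mt; have [f hf] := sx _ mt.
  rewrite mulrC -[t](subrK (\sum_a f a *: (xs a : R^o))) mulrDr.
  have m_d : mm (\sum_b d b *: (xs b : R^o)).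
    by apply: (max_sum mmP) => b; apply: (maxMl mmP).
  rewrite hf // add0r mulr_sumr; apply: big1 => a _.
  by have := hd a; rewrite E /= mulrCA => ->; rewrite mulr0.
have [||||_ spv] := @indep_card_spans _ _ mmP _ (@col_set R (socle mm) e) _
    (col_set_submodule e id0) _ 'I_e _ v _ (col_basis e (soc_ideal mm) id0 bs).
- by move=> a w ma sw i; rewrite mxE sw.
- by move=> b a; rewrite mxE; apply: (soc_prod mmP).
- exact: iv.
- by rewrite card_prod !card_ord mul1n.
have [y hy] : exists y : 'I_e -> R,
    @col_set R [set 0] e ((\col_a h' (xs a)) - \sum_b y b *: v b).
  by apply: spv => a; rewrite mxE; apply: h's.
pose Y := \sum_b y b * xs b.
have hY a : h' (xs a) = Y * xs a.
  by have := hy a; rewrite mxE [X in _ + X]mxE E mxE => /eqP; rewrite subr_eq0 => /eqP.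
have mY : mm Y by apply: (max_sum mmP) => b; apply: (maxMl mmP).
exists (Y + c) => t mt.
have [f hf] := sx _ mt.
set u := \sum_a f a *: (xs a : R^o) in hf.
have mu : mm u by apply: (max_sum mmP) => a; apply: (maxMl mmP).
have -> : h t = h' t + c * t by rewrite /h' subrK.
have -> : h' t = h' u.
  rewrite -[t](subrK u) (linear_onD h'L) ?(h'S (t - u)) ?add0r //.
  exact: smm.
have -> : h' u = Y * u.
  rewrite (linear_on_sum mmP h'L) // mulr_sumr; apply: eq_bigr => a _.
  by rewrite hY mulrCA.
have : Y * (t - u) = 0 by rewrite hf.
by rewrite mulrBr => /eqP; rewrite subr_eq0 => /eqP <-; ring.
Qed.

(** * Totally exact sequences of matrices *)

(** [R^p -B-> R^m -A-> R^n] is exact in the middle, and so is its dual. *)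
Definition totally_exact (R : comUnitRingType) (n m p : nat)
    (A : 'M[R]_(n, m)) (B : 'M[R]_(m, p)) : Prop :=
  [/\ A *m B = 0,
      forall v : 'cV[R]_m, A *m v = 0 -> exists w : 'cV[R]_p, v = B *m w &
      forall u : 'rV[R]_m, u *m B = 0 -> exists w : 'rV[R]_n, u = w *m A].

Lemma totally_exact_tr (R : comUnitRingType) (n m p : nat)
    (A : 'M[R]_(n, m)) (B : 'M[R]_(m, p)) :
  totally_exact A B -> totally_exact B^T A^T.
Proof.
move=> [AB kA kB]; split.
- by rewrite -trmx_mul AB trmx0.
- move=> v /(congr1 trmx); rewrite trmx_mul trmxK trmx0 => /kB[w hw].
  by exists w^T; rewrite -trmx_mul -hw trmxK.
- move=> v /(congr1 trmx); rewrite trmx_mul trmxK trmx0 => /kA[w hw].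
  by exists w^T; rewrite -trmx_mul -hw trmxK.
Qed.

Section Sequences.
Context (R : comUnitRingType) (mm : set R) (mmP : cube_zero_local mm).

Definition entries_in (I : set R) (n m : nat) (A : 'M[R]_(n, m)) : Prop :=
  forall i j, I (A i j).

Lemma entries_in_tr I n m (A : 'M[R]_(n, m)) :
  entries_in I A -> entries_in I A^T.
Proof. by move=> IA i j; rewrite mxE. Qed.

(** [A] can be prolonged by [k] further matrices with entries in [mm] to a
    totally exact sequence
    [R^(p_k) -> ... -> R^(p_2) -> R^(p_1) -> R^m -A-> R^n]. *)
Fixpoint prolongs (k n m : nat) (A : 'M[R]_(n, m)) : Prop :=
  if k is k'.+1 then
    exists (p : nat) (B : 'M[R]_(m, p)),
      [/\ entries_in mm B, totally_exact A B & prolongs k' B]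
  else True.

(** The image of [mm^m] under [A] contains the socle of [R^n]; it is equal to
    it if the entries of [A] lie in [mm]. *)
Definition covers_socle (n m : nat) (A : 'M[R]_(n, m)) : Prop :=
  forall v : 'cV[R]_n, col_set (socle mm) v ->
    exists w : 'cV[R]_m, col_set mm w /\ v = A *m w.

Lemma mulmx_max_soc n m (A : 'M[R]_(n, m)) (v : 'cV[R]_m) :
  entries_in mm A -> col_set (socle mm) v -> A *m v = 0.
Proof.
by move=> mA sv; apply/colP => i; rewrite !mxE; apply: big1 => j _; apply: sv.
Qed.

Lemma mulmx_max_max n m (A : 'M[R]_(n, m)) (v : 'cV[R]_m) :
  entries_in mm A -> col_set mm v -> col_set (socle mm) (A *m v).
Proof.
move=> mA mv i; rewrite mxE; apply: soc_sum => j.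
by apply: (soc_prod mmP).
Qed.

Lemma mulmx_max n m (A : 'M[R]_(n, m)) (v : 'cV[R]_m) :
  entries_in mm A -> col_set mm (A *m v).
Proof.
move=> mA i; rewrite mxE; apply: (max_sum mmP) => j.
by rewrite mulrC; apply: (maxMl mmP).
Qed.

(** A preimage [w] of a socle element with a unit entry [w_l] would make the
    residue field a direct summand of [im A].  Concretely, for linear
    [h : mm -> R] the functional [x |-> h (x_l / w_l)] on [ker A = im B] extends
    to the free module by dual exactness, and [h] is multiplication by the value
    of the extension at [w]. *)
Lemma totally_exact_covers_socle n0 n m p q
    (Z : 'M[R]_(n0, n)) (A : 'M[R]_(n, m)) (B : 'M[R]_(m, p))
    (C : 'M[R]_(p, q)) :
  ~ maximal_maps_extend mm -> entries_in mm Z -> entries_in mm B ->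
  totally_exact Z A -> totally_exact A B -> totally_exact B C ->
  covers_socle A.
Proof.
move=> next mZ mB [_ kZ _] [_ kA _] [BC _ dB] v sv.
have [w vw] := kZ _ (mulmx_max_soc mZ sv).
exists w; split=> // l; apply: contrapT => /(not_max mmP) ul; apply: next => h hL.
have mBl c : mm ((w l 0)^-1 * B l c) by apply: (maxMl mmP).
pose f : 'rV[R]_p := \row_c h ((w l 0)^-1 * B l c).
have [|mu fmu] := dB f.
  apply/rowP => d; rewrite !mxE.
  under eq_bigr do rewrite mxE mulrC.
  rewrite -(linear_on_sum mmP hL) //.
  have -> : \sum_c C c d * ((w l 0)^-1 * B l c) = (w l 0)^-1 * (B *m C) l d.
    by rewrite mxE mulr_sumr; apply: eq_bigr => c _; ring.
  by rewrite BC mxE mulr0 (linear_on0 mmP hL).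
exists ((mu *m w) 0 0) => r mr.
have [|y hy] := kA (r *: w).
  by rewrite -scalemxAr -vw; apply/colP => i; rewrite !mxE sv.
have -> : r * (mu *m w) 0 0 = (mu *m (r *: w)) 0 0 by rewrite -scalemxAr [RHS]mxE.
rewrite hy mulmxA -fmu mxE.
under eq_bigr do rewrite mxE mulrC.
rewrite -(linear_on_sum mmP hL) //; congr h.
have -> : \sum_c y c 0 * ((w l 0)^-1 * B l c) = (w l 0)^-1 * (B *m y) l 0.
  by rewrite mxE mulr_sumr; apply: eq_bigr => c _; ring.
by rewrite -hy mxE mulrCA mulVr // mulr1.
Qed.

(** * Ranks and annihilators *)

Section Counting.
Context (e r : nat) (xs : 'I_e -> R) (ss : 'I_r -> R).
Context (bx : @residue_basis R mm R^o mm (socle mm) 'I_e xs).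
Context (bs : @residue_basis R mm R^o (socle mm) [set 0] 'I_r ss).

(** With [S] the socle, [A] induces a surjection [mm^m/S^m -> S^n] with kernel
    [im B/S^m], and [B] induces an isomorphism of [R^p/mm^p] with that kernel. *)
Lemma betti_relation n m p q (A : 'M[R]_(n, m)) (B : 'M[R]_(m, p))
    (C : 'M[R]_(p, q)) :
  entries_in mm A -> entries_in mm B -> entries_in mm C ->
  totally_exact A B -> totally_exact B C ->
  covers_socle A -> covers_socle B ->
  (e * m = p + r * n)%N.
Proof.
move=> mA mB mC [AB kA _] [_ kB _] cA cB.
have idm : is_ideal mm by case: mmP.
have ids := soc_ideal mm.
have id0 : is_ideal [set 0 : R] by split=> // a _ _ -> ->; rewrite mulr0 addr0.
have b1 := col_basis m idm ids bx.
have [[Sb2 sb2] ib2] := col_basis n ids id0 bs.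
set g2 := (fun p : 'I_r * 'I_n => _) in Sb2 sb2 ib2.
have [W hW] := choice (fun k => cA _ (Sb2 k)).
pose f (k : 'I_p + 'I_r * 'I_n) : 'cV[R]_m :=
  match k with inl c => B *m delta_mx c 0 | inr k => W k end.
have Ef c : \sum_k c k *: f k =
    B *m (\col_i c (inl i)) + \sum_k c (inr k) *: W k.
  rewrite big_sumType /=; congr (_ + _).
  rewrite [\col_i _]col_sum_delta mulmx_sumr; apply: eq_bigr => i _.
  by rewrite mxE scalemxAr.
have EA c : A *m (\sum_k c k *: W k) = \sum_k c k *: g2 k.
  by rewrite mulmx_sumr; apply: eq_bigr => k _; rewrite -scalemxAr -(hW k).2.
have b2 : residue_basis mm (@col_set R mm m) (@col_set R (socle mm) m) f.
  split; first split.
  - by case=> [c|k]; [apply: mulmx_max | apply: (hW k).1].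
  - move=> v mv; have [c hc] := sb2 _ (mulmx_max_max mA mv).
    have [|y hy] := kA (v - \sum_k c k *: W k).
      rewrite mulmxBr EA; apply/colP => i; rewrite [RHS]mxE; exact: (hc i).
    exists (fun k => match k with inl i => y i 0 | inr k => c k end).
    rewrite Ef.
    have -> : \col_i y i 0 = y by apply/colP => i; rewrite mxE.
    by rewrite addrC opprD -addrA [- _ + v]addrC hy addNr => i; rewrite mxE; apply: soc0.
  - move=> c; rewrite Ef => sc.
    have m_r k : mm (c (inr k)).
      move: k; apply: ib2; rewrite -EA => i.
      have := mulmx_max_soc mA sc; rewrite mulmxDr mulmxA AB mul0mx add0r => ->.
      by rewrite mxE.
    have sW : col_set (socle mm) (\sum_k c (inr k) *: W k).
      move=> i; rewrite summxE; apply: soc_sum => k; rewrite mxE.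
      by apply: (soc_prod mmP) => //; apply: (hW k).1.
    have [|w [mw Bw]] := cB (B *m (\col_i c (inl i))).
      move=> i; have := socB (sc i) (sW i).
      by rewrite [X in X - _]mxE addrK.
    have [|z hz] := kB (\col_i c (inl i) - w); first by rewrite mulmxBr Bw subrr.
    case=> // i; have -> : c (inl i) = (\col_i c (inl i)) i 0 by rewrite mxE.
    rewrite -(subrK w (\col_i _)) hz mxE; apply: (maxD mmP) => //.
    exact: mulmx_max.
have sub : submodule (@col_set R (socle mm) m) := col_set_submodule m ids.
have := residue_basis_card mmP sub b1 b2.
rewrite card_prod card_sum card_prod !card_ord; apply.
Qed.

(** If [x w = 0], [w] is not in the socle [S], and [x mm] contains [S], then
    every [z] in [mm] with [x z = 0] lies in [(w) + S], provided that [mm/S] has one dimension more than [S].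
    Indeed [w], together with elements [y_k] such that the [x y_k] form a basis
    of [S], represents a basis of [mm/S]. *)
Lemma annihilator_generated x w : e = r.+1 -> mm w -> x * w = 0 ->
  mm x -> (forall s, socle mm s -> exists2 y, mm y & s = x * y) ->
  ~ socle mm w -> forall z, mm z -> x * z = 0 -> exists a, socle mm (z - a * w).
Proof.
move=> er mw xw mx xm nsw z mz xz.
have [[sS _] is_] := bs.
have exy k : exists y, mm y /\ ss k = x * y.
  by have [y my sy] := xm _ (sS k); exists y.
have [y hy] := choice exy.
have xS s : socle mm s -> x * s = 0 by move=> ss0; apply: ss0.
have Ey c : x * \sum_k c k * y k = \sum_k c k *: (ss k : R^o).
  by rewrite mulr_sumr; apply: eq_bigr => k _; rewrite (hy k).2 mulrCA.
pose v : option 'I_r -> R^o := family_cons (y : 'I_r -> R^o) w.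
have mv o : mm (v o) by case: o => [k|] //=; apply: (hy k).1.
have iv : @indep_mod R mm R^o (socle mm) _ v.
  move=> c; rewrite sum_option /= => sc.
  have mc k : mm (c (Some k)).
    move: k; apply: is_; rewrite /= -Ey; have := xS _ sc.
    by rewrite mulrDr [c None *: _]mulrC mulrA xw mul0r add0r.
  case=> [k|]; first exact: mc.
  apply: contrapT => /(not_max mmP) uc; apply: nsw.
  apply: (unit_soc uc); rewrite -[_ * w](addrK (\sum_k c (Some k) * y k)).
  apply: socB => //; apply: soc_sum => k.
  by apply: (soc_prod mmP) => //; apply: (hy k).1.
have [||||_ spv] := @indep_card_spans _ _ mmP R^o mm (socle mm)
    (soc_ideal mm) _ _ _ v _ bx.
- by move=> a u ma mu; apply: (soc_prod mmP).
- exact: mv.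
- exact: iv.
- by rewrite card_option !card_ord er.
have [c] := spv _ mz; rewrite sum_option /= => sc; exists (c None).
have mc k : mm (c (Some k)).
  move: k; apply: is_; rewrite /= -Ey; have := xS _ sc.
  rewrite mulrBr xz sub0r mulrDr [c None *: _]mulrC mulrA xw mul0r add0r.
  by move=> /eqP; rewrite oppr_eq0 => /eqP.
have -> : z - c None * w =
    (z - (c None *: (w : R^o) + \sum_k c (Some k) *: (y k : R^o)))
    + \sum_k c (Some k) * y k.
  by rewrite opprD addrA subrK.
apply: socD => //; apply: soc_sum => k.
by apply: (soc_prod mmP) => //; apply: (hy k).1.
Qed.

Lemma annihilator_principal x w : e = r.+1 -> x <> 0 ->
  mm x -> mm w -> x * w = 0 -> ~ socle mm w ->
  (forall s, socle mm s -> exists2 y, mm y & s = x * y) ->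
  (forall s, socle mm s -> exists2 y, mm y & s = w * y) ->
  annihilator x = principal w.
Proof.
move=> er x0 mx mw xw nsw xm wm; apply/seteqP; split=> z /=.
  rewrite /annihilator /= mulrC => xz.
  have mz : mm z.
    apply: contrapT => /(not_max mmP) uz; apply: x0.
    by apply: (mulIr uz); rewrite mul0r.
  have [a /wm [y _ zy]] := annihilator_generated er mw xw mx xm nsw mz xz.
  by exists (a + y); rewrite mulrDl [y * w]mulrC -zy addrC subrK.
by move=> [a ->]; rewrite /annihilator /= -mulrA [w * x]mulrC xw mulr0.
Qed.

End Counting.

(** The row case.  Three steps of the sequence on either side of [A] suffice:
    the ranks are compared at two consecutive spots, which uses that three
    consecutive matrices and their transposes cover socles. *)
Lemma single_entry_row n m (A : 'M[R]_(n, m)) i j :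
  noetherian R -> ~ gorenstein R -> entries_in mm A ->
  prolongs 3 A -> prolongs 3 A^T ->
  A i j != 0 -> (forall l, l != j -> A i l = 0) ->
  exact_zero_divisor (A i j).
Proof.
move=> noeth ngor mA [p1 [A1 [m1 t1 [p2 [A2 [m2 t2 [p3 [A3 [m3 t3 _]]]]]]]]].
move=> [q1 [L1 [l1 u1 [q2 [L2 [l2 u2 [q3 [L3 [l3 u3 _]]]]]]]]].
move=> /eqP x0 row0.
have next : ~ maximal_maps_extend mm.
  by move=> ext; apply: ngor; apply: (extend_gorenstein mmP).
have mAT := entries_in_tr mA.
have m1T := entries_in_tr m1; have m2T := entries_in_tr m2.
have l1T := entries_in_tr l1; have l2T := entries_in_tr l2.
have t1T := totally_exact_tr t1; have t2T := totally_exact_tr t2.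
have u1T : totally_exact L1^T A by rewrite -[A]trmxK; apply: totally_exact_tr.
have u2T := totally_exact_tr u2.
have cA : covers_socle A := totally_exact_covers_socle next l1T m1 u1T t1 t2.
have cA1 : covers_socle A1 := totally_exact_covers_socle next mA m2 t1 t2 t3.
have cL1T : covers_socle L1^T := totally_exact_covers_socle next l2T mA u2T u1T t1.
have cAT : covers_socle A^T := totally_exact_covers_socle next m1T l1 t1T u1 u2.
have cA1T : covers_socle A1^T := totally_exact_covers_socle next m2T mAT t2T t1T u1.
have cL1 : covers_socle L1 := totally_exact_covers_socle next mAT l2 u1 u2 u3.
have idm : is_ideal mm by case: mmP.
have id0 : is_ideal [set 0 : R] by split=> // a _ _ -> ->; rewrite mulr0 addr0.
have [e [xs bx]] := ideal_basis mmP noeth idm (soc_ideal mm) (soc_prod mmP).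
have [r [ss bs]] := ideal_basis mmP noeth (soc_ideal mm) id0
  (fun a v ma (sv : socle mm v) => sv a ma).
(* the rank relation and its dual, at the source and at the target of [A] *)
have r1 := betti_relation bx bs l1T mA m1 u1T t1 cL1T cA.
have r2 := betti_relation bx bs mA m1 m2 t1 t2 cA cA1.
have r3 := betti_relation bx bs mAT l1 l2 u1 u2 cAT cL1.
have r4 := betti_relation bx bs m1T mAT l1 t1T u1 cA1T cAT.
set x := A i j in x0 *.
have mx : mm x by apply: mA.
have smm s : socle mm s -> mm s.
  move=> sS; apply: contrapT => /(not_max mmP) us; apply: x0.
  by apply: (mulIr us); rewrite mul0r sS.
have n0 : (0 < n)%N by apply: leq_ltn_trans (ltn_ord i).
have m0 : (0 < m)%N by apply: leq_ltn_trans (ltn_ord j).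
have r_neq0 : r <> 0%N.
  move=> r0; have S0 s : socle mm s -> s = 0.
    move=> /bs.1.2 [c]; rewrite big1 ?subr0 // => k.
    by exfalso; move: (k); rewrite r0 => -[].
  apply: x0; apply: (S0) => t mt; apply: (S0); exact: (soc_prod mmP).
have r_neq1 : r <> 1%N.
  move=> r1'; move: ss bs; rewrite r1' => ss bs; apply: next.
  exact: (socle_dim1_extend mmP smm bx bs).
have er : e = r.+1.
  clear -r1 r2 r3 r4 r_neq0 r_neq1 n0 m0.
  have r_gt1 : (1 < r)%N by case: (r) r_neq0 r_neq1 => [|[]].
  (* comparing a rank relation with its dual gives (r - 1) (q1 - m) = 0 *)
  have q1m : q1 = m by nia.
  have p1n : p1 = n by nia.
  subst q1 p1; nia.
have xm s : socle mm s -> exists2 y, mm y & s = x * y.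
  move=> sS; have [|w [mw hw]] := cA (s *: delta_mx i 0).
    by move=> k; rewrite !mxE mulrC; apply: socMl.
  exists (w j 0) => //; move/colP/(_ i): hw.
  rewrite !mxE !eqxx mulr1 => ->; rewrite (bigD1 j) //= big1 ?addr0 //.
  by move=> l /row0 ->; rewrite mul0r.
have xA1 c : x * A1 j c = 0.
  have : (A *m A1) i c = 0 by case: t1 => -> _ _; rewrite mxE.
  rewrite mxE (bigD1 j) //= big1 ?addr0 //.
  by move=> l /row0 ->; rewrite mul0r.
have SA1 s : socle mm s -> exists2 v : 'cV[R]_p1, col_set mm v &
    s = \sum_c A1 j c * v c 0.
  move=> sS; have [|v [mv hv]] := cA1 (s *: delta_mx j 0).
    by move=> k; rewrite !mxE mulrC; apply: socMl.
  by exists v => //; move/colP/(_ j): hv; rewrite !mxE !eqxx mulr1.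
have S_neq0 : ~ (forall s, socle mm s -> s = 0).
  by move=> S0; apply: x0; apply: (S0) => t mt; apply: (S0); apply: (soc_prod mmP).
have [c nsw] : exists c, ~ socle mm (A1 j c).
  apply: contrapT => nc; apply: S_neq0 => s /SA1 [v mv ->]; apply: big1 => c _.
  rewrite mulrC; have : socle mm (A1 j c); last exact.
  by apply: contrapT => ns; apply: nc; exists c.
set w := A1 j c in nsw.
have mw : mm w by apply: m1.
have nsx : ~ socle mm x.
  by move=> sx; apply: S_neq0 => s /xm [y my ->]; rewrite mulrC; apply: sx.
(* modulo the socle the [j]-th row of [A1] consists of multiples of [w] *)
have wm s : socle mm s -> exists2 y, mm y & s = w * y.
  move=> /SA1 [v mv ->].
  have [a ha] := choice (fun d => annihilator_generated bx bs er mw (xA1 c) mx xm nsw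
    (m1 j d) (xA1 d)).
  exists (\sum_d a d * v d 0).
    by apply: (max_sum mmP) => d; apply: (maxMl mmP).
  rewrite mulr_sumr; apply: eq_bigr => d _.
  rewrite mulrCA mulrA; apply/eqP; rewrite -subr_eq0 -mulrBl; apply/eqP.
  by rewrite mulrC; apply: (ha d).
have w0 : w <> 0 by move=> w0; apply: nsw; rewrite w0; apply: soc0.
split; [exact/(max_nonunit mmP) | exact/eqP | exists w; split].
  exact: (annihilator_principal bx bs er x0 mx mw (xA1 c) nsw xm wm).
apply: (annihilator_principal bx bs er w0 mw mx _ nsx wm xm).
by rewrite mulrC; apply: xA1.
Qed.

End Sequences.

(** * Comparison of presentations *)

Section MatrixLifting.
Context (R : comUnitRingType).

Lemma mulmx_delta_col n m (A : 'M[R]_(n, m)) i j :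
  (A *m (delta_mx j 0 : 'cV[R]_m)) i 0 = A i j.
Proof. by rewrite -colE mxE. Qed.

Lemma matrix_eq_on_cols n m (A B : 'M[R]_(n, m)) :
  (forall v : 'cV[R]_m, A *m v = B *m v) -> A = B.
Proof.
by move=> AB; apply/matrixP => i j; rewrite -mulmx_delta_col AB mulmx_delta_col.
Qed.

Lemma lift_columns n m k (B : 'M[R]_(n, m)) (A : 'M[R]_(n, k)) :
  (forall v : 'cV[R]_k, exists w : 'cV[R]_m, A *m v = B *m w) ->
  exists W : 'M[R]_(m, k), A = B *m W.
Proof.
move=> AB; have [w hw] := choice (fun j => AB (delta_mx j 0)).
exists (\matrix_(i, j) w j i 0); apply/matrixP => i j.
rewrite -mulmx_delta_col hw !mxE; apply: eq_bigr => l _; by rewrite mxE.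
Qed.

Lemma linear_col_comb (a : nat) (M : lmodType R) (f : {linear 'cV[R]_a -> M}) v :
  f v = \sum_j v j 0 *: f (delta_mx j 0).
Proof.
rewrite {1}[v]col_sum_delta linear_sum; apply: eq_bigr => j _; exact: linearZ.
Qed.

Lemma lift_through_surjection (a b : nat) (M : lmodType R)
    (f : {linear 'cV[R]_a -> M}) (g : {linear 'cV[R]_b -> M}) :
  (forall x, exists y, g y = x) ->
  exists X : 'M[R]_(b, a), forall v, g (X *m v) = f v.
Proof.
move=> gs; have [w hw] := choice (fun j => gs (f (delta_mx j 0))).
exists (\matrix_(i, j) w j i 0) => v; rewrite [RHS]linear_col_comb.
rewrite [in LHS](col_sum_delta v) mulmx_sumr linear_sum; apply: eq_bigr => j _.
rewrite -scalemxAr linearZ -hw; congr (_ *: g _).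
by apply/colP => i; rewrite mulmx_delta_col mxE.
Qed.

Lemma linear_matrix (a b : nat) (f : {linear 'cV[R]_a -> 'cV[R]_b}) :
  exists X : 'M[R]_(b, a), forall v, f v = X *m v.
Proof.
have [|X hX] := @lift_through_surjection a b _ f (idfun : {linear 'cV[R]_b -> 'cV[R]_b}).
  by move=> x; exists x.
by exists X => v; apply/esym/hX.
Qed.

End MatrixLifting.

Section Comparison.
Context (R : comUnitRingType).

(** Comparison data between [P] and [Q], two differentials at the same place of
    two free resolutions of one module, or of their duals: a map [alpha]
    between the sources that preserves kernels, a chain map [(beta, beta0)]
    backwards, and a homotopy [h] with [1 - alpha beta - h Q] taking values in
    [ker Q]. *)
Definition comparable_maps p0 p1 q0 q1
    (P : 'M[R]_(p0, p1)) (Q : 'M[R]_(q0, q1)) : Prop :=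
  exists (alpha : 'M[R]_(q1, p1)) (beta : 'M[R]_(p1, q1))
         (beta0 : 'M[R]_(p0, q0)) (h : 'M[R]_(q1, q0)),
    [/\ forall v : 'cV[R]_p1, P *m v = 0 -> Q *m (alpha *m v) = 0,
        P *m beta = beta0 *m Q &
        Q *m (1%:M - alpha *m beta - h *m Q) = 0].

(** Comparison data propagate along resolutions, and with them exactness of the
    dual sequence. *)
Lemma comparable_next p0 p1 p2 q0 q1 q2
    (P : 'M[R]_(p0, p1)) (P' : 'M[R]_(p1, p2))
    (Q : 'M[R]_(q0, q1)) (Q' : 'M[R]_(q1, q2)) :
  comparable_maps P Q -> totally_exact P P' -> Q *m Q' = 0 ->
  (forall v : 'cV[R]_q1, Q *m v = 0 -> exists w : 'cV[R]_q2, v = Q' *m w) ->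
  totally_exact Q Q' /\ comparable_maps P' Q'.
Proof.
move=> [al [be [be0 [h [kal Pbe hom]]]]] [PP kP dP] QQ kQ; split.
  split=> // u uQ.
  have uker (v : 'cV[R]_q1) : Q *m v = 0 -> u *m v = 0.
    by move=> /kQ [w ->]; rewrite mulmxA uQ mul0mx.
  have [|w hw] := dP (u *m al).
    apply: matrix_eq_on_cols => v; rewrite mul0mx -!mulmxA; apply: uker.
    by apply: kal; rewrite mulmxA PP mul0mx.
  exists (w *m be0 + u *m h).
  have u0 : u *m (1%:M - al *m be - h *m Q) = 0.
    apply: matrix_eq_on_cols => v; rewrite mul0mx -!mulmxA; apply: uker.
    by rewrite mulmxA hom mul0mx.
  rewrite mulmxDl -[w *m be0 *m Q]mulmxA -Pbe mulmxA -hw.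
  move: u0; rewrite !mulmxBr mulmx1 !mulmxA => /eqP.
  by rewrite -addrA -opprD subr_eq0 => /eqP.
have [al2 hal] : exists W, al *m P' = Q' *m W.
  apply: lift_columns => v; rewrite -mulmxA; apply: kQ; apply: kal.
  by rewrite mulmxA PP mul0mx.
have [be2 hbe] : exists W, be *m Q' = P' *m W.
  apply: lift_columns => v; rewrite -mulmxA; apply: kP.
  by rewrite mulmxA Pbe -mulmxA [Q *m _]mulmxA QQ mul0mx mulmx0.
have [h1 hh1] : exists W, 1%:M - al *m be - h *m Q = Q' *m W.
  by apply: lift_columns => v; apply: kQ; rewrite mulmxA hom mul0mx.
exists al2, be2, be, h1; split=> //.
  by move=> v Pv; rewrite mulmxA -hal -mulmxA Pv mulmx0.
rewrite !mulmxBr mulmx1 !mulmxA -hal -hh1 -[al *m P' *m be2]mulmxA -hbe.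
rewrite !mulmxBl mul1mx -[h *m Q *m Q']mulmxA QQ mulmx0 subr0 mulmxA.
by rewrite subrr.
Qed.

(** The kernel of [Q] is the image of a matrix; this uses no finiteness
    property of [R]. *)
Lemma comparable_kernel p0 p1 p2 q0 q1
    (P : 'M[R]_(p0, p1)) (P' : 'M[R]_(p1, p2)) (Q : 'M[R]_(q0, q1)) :
  comparable_maps P Q -> totally_exact P P' ->
  exists (q : nat) (G : 'M[R]_(q1, q)),
    forall v : 'cV[R]_q1, Q *m v = 0 <-> exists w : 'cV[R]_q, v = G *m w.
Proof.
move=> [al [be [be0 [h [kal Pbe hom]]]]] [PP kP _].
exists (p2 + q1)%N, (row_mx (al *m P') (1%:M - al *m be - h *m Q)) => v.
split=> [Qv|[w ->]].
  have [|y hy] := kP (be *m v); first by rewrite mulmxA Pbe -mulmxA Qv mulmx0.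
  exists (col_mx y v); rewrite mul_row_col -mulmxA -hy !mulmxBl mul1mx.
  by rewrite -[h *m Q *m v]mulmxA Qv mulmx0 subr0 mulmxA addrC subrK.
rewrite -(vsubmxK w) mul_row_col mulmxDr [Q *m (_ *m dsubmx _)]mulmxA hom.
rewrite mul0mx addr0 -mulmxA; apply: kal.
by rewrite mulmxA PP mul0mx.
Qed.

(** Two presentations of the same module are comparable, and so are their
    transposes. *)
Lemma comparable_presentations (M : lmodType R) p0 p1 q0 q1
    (P : 'M[R]_(p0, p1)) (Q : 'M[R]_(q0, q1)) :
  presented_by M P -> presented_by M Q ->
  comparable_maps P Q /\ comparable_maps P^T Q^T.
Proof.
move=> [f [fs fP]] [g [gs gQ]].
have [a0 ha0] := lift_through_surjection f gs.
have [b0 hb0] := lift_through_surjection g fs.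
have fP0 v : f (P *m v) = 0 by apply/fP; exists v.
have gQ0 v : g (Q *m v) = 0 by apply/gQ; exists v.
have [a1 ha1] : exists W, a0 *m P = Q *m W.
  apply: lift_columns => v.
  have /gQ [w hw] : g (a0 *m P *m v) = 0 by rewrite -mulmxA ha0.
  by exists w.
have [b1 hb1] : exists W, b0 *m Q = P *m W.
  apply: lift_columns => v.
  have /fP [w hw] : f (b0 *m Q *m v) = 0 by rewrite -mulmxA hb0.
  by exists w.
have [h hh] : exists W, 1%:M - a0 *m b0 = Q *m W.
  apply: lift_columns => v.
  have /gQ [w hw] : g ((1%:M - a0 *m b0) *m v) = 0.
    by rewrite mulmxBl mul1mx linearB /= -mulmxA ha0 hb0 subrr.
  by exists w.
split.
  exists a1, b1, b0, h; split=> //.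
    by move=> v Pv; rewrite mulmxA -ha1 -mulmxA Pv mulmx0.
  rewrite !mulmxBr mulmx1 !mulmxA -ha1 -hh mulmxBl mul1mx.
  by rewrite -[a0 *m P *m b1]mulmxA -hb1 mulmxA subrr.
exists b0^T, a0^T, a1^T, h^T; split.
- move=> v Pv; rewrite mulmxA -trmx_mul hb1 trmx_mul -mulmxA.
  by rewrite Pv mulmx0.
- by rewrite -!trmx_mul ha1.
- have -> : 1%:M - b0^T *m a0^T - h^T *m Q^T = (1%:M - a0 *m b0 - Q *m h)^T.
    by rewrite !raddfB /= !trmx_mul trmx1.
  by rewrite -trmx_mul hh subrr mul0mx trmx0.
Qed.

(** [A] can be prolonged by [k] further matrices to a totally exact sequence. *)
Fixpoint freely_prolongs (k n m : nat) (A : 'M[R]_(n, m)) : Prop :=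
  if k is k'.+1 then
    exists (p : nat) (B : 'M[R]_(m, p)), totally_exact A B /\ freely_prolongs k' B
  else True.

Context (mm : set R) (mmP : cube_zero_local mm).

(** Generators involved in a relation with a unit coefficient are dropped. *)
Lemma minimal_generators n p (G : 'M[R]_(n, p)) :
  exists (q : nat) (H : 'M[R]_(n, q)),
    (forall v : 'cV[R]_n, (exists w : 'cV[R]_p, v = G *m w) <->
                          (exists w : 'cV[R]_q, v = H *m w)) /\
    (forall w : 'cV[R]_q, H *m w = 0 -> col_set mm w).
Proof.
elim: p G => [|p IH] G.
  by exists 0%N, G; split=> // w _ [].
have [Gmin|] := pselect (forall w : 'cV[R]_p.+1, G *m w = 0 -> col_set mm w).
  by exists p.+1, G.
move=> /existsNP [u] /not_implyP [Gu] /existsNP [l] /(not_max mmP) ul.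
have [q [H [hH Hmin]]] := IH (col' l G).
exists q, H; split=> // v; split=> [[w ->]|/hH [w ->]].
  apply/hH; exists (row' l (w - (w l 0 / u l 0) *: u)).
  have -> : G *m w = G *m (w - (w l 0 / u l 0) *: u).
    by rewrite mulmxBr -scalemxAr Gu scaler0 subr0.
  apply/colP => i; rewrite !mxE (bigD1_ord l) //= !mxE divrK // subrr mulr0 add0r.
  by apply: eq_bigr => k _; rewrite !mxE.
exists (\col_k oapp (fun k' => w k' 0) 0 (unlift l k)).
apply/colP => i; rewrite !mxE [RHS](bigD1_ord l) //= !mxE unlift_none mulr0 add0r.
by apply: eq_bigr => k _; rewrite !mxE liftK.
Qed.

(** If [ker Q <= mm^q1], then choosing minimal generators of the successive
    kernels prolongs [Q] by matrices over [mm]; this minimal resolution inherits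
    total exactness from any comparable totally exact sequence. *)
Lemma prolongs_comparable k p0 p1 q0 q1
    (P : 'M[R]_(p0, p1)) (Q : 'M[R]_(q0, q1)) :
  comparable_maps P Q -> (forall v : 'cV[R]_q1, Q *m v = 0 -> col_set mm v) ->
  freely_prolongs k P -> prolongs mm k Q.
Proof.
elim: k p0 p1 q0 q1 P Q => //= k IH p0 p1 q0 q1 P Q cPQ Qmin [p2 [P' [tP fP']]].
have [q' [G hG]] := comparable_kernel cPQ tP.
have [q [H [hH Hmin]]] := minimal_generators G.
have QH (w : 'cV[R]_q) : Q *m (H *m w) = 0 by apply/hG/hH; exists w.
have QH0 : Q *m H = 0.
  by apply: matrix_eq_on_cols => w; rewrite -mulmxA QH mul0mx.
have [|tQ cPQ'] := comparable_next cPQ tP QH0.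
  by move=> v /hG/hH.
exists q, H; split=> //; last exact: IH cPQ' Hmin fP'.
by move=> i j; rewrite -mulmx_delta_col; apply: Qmin.
Qed.

End Comparison.

(** * Complete resolutions in matrix form *)

(** The complex [d] of free modules is expressed by the matrices [D] through
    isomorphisms [f i : F i -> R^(b i)] with inverses [g i]. *)
Section CompleteResolution.
Context (R : comUnitRingType).
Context (F : int -> lmodType R) (d : forall i : int, {linear F (i + 1) -> F i}).
Context (b : int -> nat) (f : forall i, {linear F i -> 'cV[R]_(b i)}).
Context (g : forall i, {linear 'cV[R]_(b i) -> F i}).
Context (fK : forall i, cancel (f i) (g i)) (gK : forall i, cancel (g i) (f i)).
Context (D : forall i, 'M[R]_(b i, b (i + 1))).
Context (DE : forall i x, f i (d i x) = D i *m f (i + 1) x).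

Lemma complex_totally_exact i :
  exact_complex d -> exact_dual_complex d -> totally_exact (D i) (D (i + 1)).
Proof.
move=> ex dex; split.
- apply: matrix_eq_on_cols => v; rewrite mul0mx -mulmxA -[v]gK -!DE.
  have /ex -> : exists y, d (i + 1) y = d (i + 1) (g _ v) by exists (g _ v).
  exact: linear0.
- move=> v; rewrite -[v]gK -DE => /(congr1 (@g i)); rewrite fK linear0.
  by move=> /ex [y <-]; exists (f _ y); rewrite DE.
- move=> u uD.
  have lphi : linear (fun x => (u *m f (i + 1) x) 0 0 : R^o).
    by move=> a x y; rewrite linearP mulmxDr -scalemxAr !mxE.
  pose phi : {linear F (i + 1) -> R^o} :=
    HB.pack (fun x => (u *m f (i + 1) x) 0 0 : R^o)
      (GRing.isLinear.Build _ _ _ _ _ lphi).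
  have [|psi hpsi] := (dex i phi).1.
    by move=> x; rewrite /phi /= DE mulmxA uD mul0mx mxE.
  exists (\row_j psi (g i (delta_mx j 0))); apply: matrix_eq_on_cols => v.
  rewrite -[v]gK -mulmxA -DE; apply/colP => k; rewrite ord1.
  rewrite -[LHS]/(phi (g _ v)) -hpsi -[d i _ in LHS]fK mxE.
  rewrite [X in g i X]col_sum_delta !linear_sum; apply: eq_bigr => j _.
  by rewrite !linearZ mxE mulrC.
Qed.

Lemma cokernel_presented_by (M : lmodType R) i :
  is_cokernel (d i) M -> presented_by M (D i).
Proof.
move=> [p [ps pex]]; exists (p \o g i); split=> [x|v].
  by have [y <-] := ps x; exists (f i y); rewrite /= fK.
split=> [/pex [y hy]|[w <-]] /=.
  by exists (f _ y); rewrite -DE hy gK.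
apply/pex; exists (g _ w).
by rewrite -[LHS]fK DE gK.
Qed.

Context (tD : forall i, totally_exact (D i) (D (i + 1))).

Lemma complex_prolongs k i : freely_prolongs k (D i).
Proof. by elim: k i => //= k IH i; exists (b (i + 1 + 1)), (D (i + 1)). Qed.

Lemma complex_prolongs_tr k i : freely_prolongs k (D i)^T.
Proof.
elim: k i => //= k IH i; rewrite -(subrK 1 i).
exists (b (i - 1)), (D (i - 1))^T; split=> //.
exact: totally_exact_tr.
Qed.

End CompleteResolution.

(** A complete resolution of [M] is cut at [M]: one half prolongs a presentation
    [P] of [M], the other half, dualized, prolongs [P^T]. *)
Lemma totally_reflexive_presentation (R : comUnitRingType) (M : lmodType R) :
  totally_reflexive M ->
  exists (p0 p1 : nat) (P : 'M[R]_(p0, p1)),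
    [/\ presented_by M P, forall k, freely_prolongs k P &
        forall k, freely_prolongs k P^T].
Proof.
move=> [_ [F [d [free ex dex cok]]]].
have iso i : exists n (f : {linear F i -> 'cV[R]_n}) (g : {linear 'cV[R]_n -> F i}),
    cancel f g /\ cancel g f.
  have [n [f [g fK gK]]] := free i; exists n.
  have lg : linear g.
    move=> a x y; apply: (can_inj fK); rewrite gK linearP.
    by congr (_ *: _ + _); rewrite gK.
  pose gM := GRing.isLinear.Build _ _ _ _ g lg.
  pose gl : {linear 'rV[R]_n -> F i} := HB.pack g gM.
  exists [the {linear F i -> 'cV[R]_n} of trmx \o f].
  exists [the {linear 'cV[R]_n -> F i} of gl \o trmx].
  by split=> x /=; rewrite ?trmxK ?fK ?gK ?trmxK.
have {}iso i : {n : nat & {f : {linear F i -> 'cV[R]_n} &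
    {g : {linear 'cV[R]_n -> F i} | cancel f g /\ cancel g f}}}.
  by have [n /cid[f /cid[g fgK]]] := cid (iso i); exists n, f, g.
pose b i := projT1 (iso i).
pose f i : {linear F i -> 'cV[R]_(b i)} := projT1 (projT2 (iso i)).
pose g i : {linear 'cV[R]_(b i) -> F i} := sval (projT2 (projT2 (iso i))).
have fgK i : cancel (f i) (g i) /\ cancel (g i) (f i).
  exact: svalP (projT2 (projT2 (iso i))).
have fK i := (fgK i).1; have gK i := (fgK i).2.
have D i : {D : 'M[R]_(b i, b (i + 1)) |
    forall x, f i (d i x) = D *m f (i + 1) x}.
  have [D hD] :=
    cid (linear_matrix [the {linear _ -> _} of f i \o d i \o g (i + 1)]).
  by exists D => x; rewrite -hD /= fK.
have DE i := svalP (D i).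
have tD i := complex_totally_exact fK gK DE i ex dex.
exists (b 0), (b (0 + 1)), (sval (D 0)); split=> [|k|k].
- exact: (cokernel_presented_by fK gK DE cok).
- exact: (complex_prolongs (D := fun i => sval (D i)) tD).
- exact: (complex_prolongs_tr (D := fun i => sval (D i)) tD).
Qed.

(** * Free summands *)

Section FunctionalKernel.
Context (R : comUnitRingType) (M : lmodType R) (phi : {linear M -> R^o}).

Definition in_kernel : {pred M} := fun x => phi x == 0.

Fact in_kernel_closed : submod_closed in_kernel.
Proof.
split=> [|a x y]; rewrite !unfold_in ?linear0 // => /eqP px /eqP py.
by rewrite linearP px py scaler0 addr0.
Qed.

HB.instance Definition _ :=
  GRing.isSubmodClosed.Build R M in_kernel in_kernel_closed.

(** The kernel of [phi] as a module. *)
Definition functional_kernel : Type := {x : M | x \in in_kernel}.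

HB.instance Definition _ := SubChoice.on functional_kernel.
HB.instance Definition _ :=
  [SubChoice_isSubLmodule of functional_kernel by <:].

(** [x |-> (phi x, x - phi x x1)] is an isomorphism. *)
Lemma surjective_functional_splits x1 :
  phi x1 = 1 -> isomorphic M (R^o * functional_kernel)%type.
Proof.
move=> px1.
have kx x : x - phi x *: x1 \in in_kernel.
  by rewrite unfold_in linearB linearZ /= px1 [_ *: 1]mulr1 subrr.
pose s x : (R^o * functional_kernel)%type := (phi x, Sub (x - phi x *: x1) (kx x)).
have ls : linear s.
  move=> a x y; congr (_, _); first exact: linearP.
  apply: val_inj; rewrite /= linearP /= scalerDl scalerBr -scalerA.
  by rewrite opprD addrACA.
pose sM := GRing.isLinear.Build _ _ _ _ s ls.
exists (HB.pack s sM : {linear M -> (R^o * functional_kernel)%type}).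
exists (fun q => q.1 *: x1 + val q.2) => [x|[a y]] /=.
  by rewrite addrC subrK.
have py : phi (val y) = 0 by apply/eqP; exact: (valP y).
have e1 : phi (a *: x1 + val y) = a.
  by rewrite linearP px1 py addr0 [_ *: _]mulr1.
by congr (_, _) => //; apply: val_inj; rewrite /= e1 addrC addKr.
Qed.

End FunctionalKernel.

(** A functional [v^T] on [R^n] that kills [im Psi] induces one on [M]; a unit
    entry of [v] makes it surjective, and it then splits off a free summand. *)
Lemma no_free_summand_kernel (R : comUnitRingType) (mm : set R)
    (M : lmodType R) n m (Psi : 'M[R]_(n, m)) :
  cube_zero_local mm -> without_free_summands M -> presented_by M Psi ->
  forall v : 'cV[R]_n, Psi^T *m v = 0 -> col_set mm v.
Proof.
move=> mmP nofree [q [qs qex]] v Pv i; apply: contrapT => /(not_max mmP) ui.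
apply: nofree.
have uq x y : q x = q y -> (v^T *m x) 0 0 = (v^T *m y) 0 0.
  move=> qxy; have /qex [z hz] : q (x - y) = 0 by rewrite linearB /= qxy subrr.
  rewrite -(subrK y x) -hz mulmxDr mulmxA -[Psi]trmxK -trmx_mul Pv.
  by rewrite trmx0 mul0mx add0r.
have [s hs] := choice qs.
pose phi x : R^o := (v^T *m s x) 0 0.
have phiq x : phi (q x) = (v^T *m x) 0 0 by apply: uq; rewrite hs.
have lphi : linear phi.
  move=> a x y; rewrite -{1}(hs x) -{1}(hs y) -linearP phiq.
  by rewrite mulmxDr -scalemxAr mxE [X in X + _]mxE.
pose phiM := GRing.isLinear.Build _ _ _ _ phi lphi.
pose phil : {linear M -> R^o} := HB.pack phi phiM.
have p1 : phil (q ((v i 0)^-1 *: delta_mx i 0)) = 1.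
  by rewrite /= phiq -scalemxAr mxE mulmx_delta_col mxE mulVr.
exists R^o, (functional_kernel phil); split.
- exists 1%N.
  have lr : linear (fun a : R^o => (\row_(j < 1) a : 'rV[R]_1)).
    by move=> a x y; apply/rowP => j; rewrite !mxE.
  exists (HB.pack (fun a : R^o => (\row_(j < 1) a : 'rV[R]_1))
    (GRing.isLinear.Build _ _ _ _ _ lr) : {linear R^o -> 'rV[R]_1}).
  exists (fun w : 'rV[R]_1 => w 0 0) => [a|w] /=; first by rewrite mxE.
  by apply/rowP => j; rewrite mxE ord1.
- by exists 1; apply: oner_neq0.
- exact: surjective_functional_splits p1.
Qed.

Theorem mainTheorem2 (R : comUnitRingType) (mm : set R)
    (R_noetherian : noetherian R) (R_local : local_ring mm)
    (mm3 : ideal_exp mm 3 = [set 0])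
    (R_not_gorenstein : ~ gorenstein R)
    (M : lmodType R)
    (M_totally_reflexive : totally_reflexive M)
    (M_no_free_summand : without_free_summands M)
    (n m : nat) (Psi : 'M[R]_(n, m))
    (M_presented : presented_by M Psi)
    (Psi_minimal : minimal_matrix mm Psi)
    (i : 'I_n) (j : 'I_m)
    (Psi_ij_neq0 : Psi i j != 0)
    (only_nonzero : (forall k : 'I_n, k != i -> Psi k j = 0) \/
                    (forall l : 'I_m, l != j -> Psi i l = 0)) :
  exact_zero_divisor (Psi i j).
Proof.
have mmP := local_ring_cube_zero R_local mm3.
have [p0 [p1 [P [Ppres Pright Pleft]]]] :=
  totally_reflexive_presentation M_totally_reflexive.
have [cPsi cPsiT] := comparable_presentations Ppres M_presented.
have [mPsi kPsi] := Psi_minimal.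
have right3 : prolongs mm 3 Psi := prolongs_comparable mmP cPsi kPsi (Pright 3%N).
have left3 : prolongs mm 3 Psi^T.
  apply: (prolongs_comparable mmP cPsiT _ (Pleft 3%N)).
  exact: no_free_summand_kernel M_no_free_summand M_presented.
have [col|row] := only_nonzero; last first.
  exact: (single_entry_row mmP).
have -> : Psi i j = Psi^T j i by rewrite mxE.
apply: (single_entry_row mmP) => //; rewrite ?trmxK ?mxE //.
- exact: entries_in_tr.
- by move=> l /col; rewrite mxE.
Qed.
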